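(* Suppose $\mathbb E[P_{<t}]\le t-1$ for all $t\ge2$. Then the perishing process is $\delta$-offset-expiring for any $$\delta\ \ge\ \sum_{t=2}^T\min\left\{\left(\frac{\mathrm{Std}[P_{<t}]}{t-\mathbb E[P_{<t}]}\right)^2,\ \exp\left(-\frac{2(t-\mathbb E[P_{<t}])^2}{|\mathcal B^{rand}_{<t}|}\right)\right\}\mathbf 1\{|\mathcal B^{rand}_{<t}|>0\} .$$
   Context: There are $T$ rounds and a set $\mathcal B$ of $B=T$ units of a resource, and exactly one individual arrives in each round almost surely ($N_t=1$ for all $t\in\{1,\dots,T\}$, so $N=T$). Unit $b\in\mathcal B$ has a random perishing time $T_b\in\{1,2,\dots\}$; the perishing times are i.i.d. across units. $P_{<t}=\sum_{b\in\mathcal B}\mathbf 1\{T_b<t\}$ and $\mathrm{Std}[\cdot]$ denotes standard deviation. $\mathcal B^{rand}_{<t}=\{b\in\mathcal B:\Pr(T_b<t)\in(0,1)\}$; a summand with $\mathcal B^{rand}_{<t}=\emptyset$ is zero. For $\delta\in(0,1)$, the perishing process is $\delta$-offset-expiring if $\Pr\left(\frac{P_{<t}}{B}\le\frac{N_{<t}}{N}\ \forall t\ge2\right)\ge1-\delta$ with $N_{<t}=\sum_{t'<t}N_{t'}$, i.e. here, if $\Pr(P_{<t}\le t-1\ \forall t\in\{2,\dots,T\})\ge1-\delta$. *)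

(* Defs.v *)
From HB Require Import structures.
From mathcomp Require Import all_boot all_order all_algebra.
From mathcomp Require Import all_classical all_reals all_analysis.

Set Implicit Arguments.
Unset Strict Implicit.
Unset Printing Implicit Defensive.

Import Order.TTheory GRing.Theory Num.Theory.
Import numFieldNormedType.Exports.

Local Open Scope classical_set_scope.
Local Open Scope ring_scope.

(* Mutual independence: the product rule over every finite subfamily [J] and
   every choice of measurable sets. *)
Definition mutually_independent d d' (Omega : measurableType d)
    (S : measurableType d') (R : realType) (P : probability Omega R)
    (I : finType) (X : I -> {RV P >-> S}) : Prop :=
  forall (J : {set I}) (A : I -> set S), (forall i, measurable (A i)) ->
    (P (\bigcap_(i in [set` J]) (X i @^-1` A i)) =
     \prod_(i in J) P (X i @^-1` A i))%E.

Definition identically_distributed d d' (Omega : measurableType d)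
    (S : measurableType d') (R : realType) (P : probability Omega R)
    (I : finType) (X : I -> {RV P >-> S}) : Prop :=
  forall (i j : I) (A : set S), measurable A ->
    distribution P (X i) A = distribution P (X j) A.

Definition iid d d' (Omega : measurableType d) (S : measurableType d')
    (R : realType) (P : probability Omega R) (I : finType)
    (X : I -> {RV P >-> S}) : Prop :=
  mutually_independent X /\ identically_distributed X.

(* ['V_P[X]] is valued in [\bar R]; it is finite for the bounded [X] considered
   below, so that [fine] loses nothing. *)
Definition Std d (Omega : measurableType d) (R : realType)
    (P : probability Omega R) (X : Omega -> R) : R :=
  Num.sqrt (fine 'V_P[X]).

Section perishing.
Context d (Omega : measurableType d) (R : realType) (P : probability Omega R).
Context (Unit : finType) (perish : Unit -> {RV P >-> nat}).

Definition perished_before (t : nat) (w : Omega) : R :=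
  \sum_(b : Unit) \1_[set w' | (perish b w' < t)%N] w.

Definition random_units_before (t : nat) : {set Unit} :=
  [set b | (0 < P [set w | (perish b w < t)%N] < 1)%E].

(* Rounds are numbered from 1. *)
Definition arrivals_before (N : nat -> {RV P >-> nat}) (t : nat) (w : Omega)
    : nat :=
  (\sum_(1 <= s < t) N s w)%N.

Definition total_arrivals (N : nat -> {RV P >-> nat}) (T : nat) (w : Omega)
    : nat :=
  arrivals_before N T.+1 w.

Definition offset_event (T : nat) (N : nat -> {RV P >-> nat}) : set Omega :=
  [set w | forall t : nat, (2 <= t <= T)%N ->
     perished_before t w / #|Unit|%:R <=
     (arrivals_before N t w)%:R / (total_arrivals N T w)%:R].

Definition offset_expiring (T : nat) (N : nat -> {RV P >-> nat}) (delta : R)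
    : Prop :=
  ((1 - delta)%:E <= P (offset_event T N))%E.

Definition mean_perished_before (t : nat) : R :=
  fine 'E_P[perished_before t].

Definition chebyshev_term (t : nat) : R :=
  (Std P (perished_before t) / (t%:R - mean_perished_before t)) ^+ 2.

Definition hoeffding_term (t : nat) : R :=
  expR (- (2 * (t%:R - mean_perished_before t) ^+ 2
           / #|random_units_before t|%:R)).

End perishing.

(* Main.v *)
Require Import Defs.
From HB Require Import structures.
From mathcomp Require Import all_boot all_order all_algebra.
From mathcomp Require Import all_classical all_reals all_analysis.
From mathcomp Require Import measurable_realfun ring lra.

Set Implicit Arguments.
Unset Strict Implicit.
Unset Printing Implicit Defensive.

Import Order.TTheory GRing.Theory Num.Theory.
Import numFieldNormedType.Exports.

Local Open Scope classical_set_scope.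
Local Open Scope ring_scope.

(* As perishing counts are integers, offset expiry fails only if the count
   before some round t reaches t, or on the null set where some round does not
   have exactly one arrival.  The count is a sum of independent indicators with
   mean at most t - 1 < t, so the probability that it reaches t is bounded both
   by Chebyshev's and by Hoeffding's inequality (deterministic units contribute
   nothing to the Hoeffding exponent), and a union bound over t concludes.  When
   every unit is deterministic the Chernoff bound is exp (- s (t - mean)) for
   all s > 0, so the probability vanishes. *)

(** * Exponentials of a Bernoulli variable and of a sum of indicators *)

Lemma is_derive_ge0_le (R : realType) (f df : R -> R) (x : R) :
  (forall y : R, is_derive y 1 f (df y)) ->
  (forall y, 0 <= y -> 0 <= df y) -> 0 <= x -> f 0 <= f x.
Proof.
move=> fdf df0 x0.
have [|y /[!in_itv]/= /andP[y0 _] fxE] := MVT_segment x0 (fun y _ => fdf y).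
  by apply: derivable_within_continuous => y _; have [] := fdf y.
by rewrite -subr_ge0 fxE subr0 mulr_ge0 ?df0.
Qed.

(* With D s := 1 + p (e^s - 1), the ratio h of the two sides satisfies h 0 = 1
   and - h' = k h, where k 0 = 0 and k' = 1/4 - p (1 - p) e^s / D^2 is
   nonnegative by AM-GM applied to D = (1 - p) + p e^s. *)
Lemma bernoulli_hoeffding (R : realType) (p s : R) : 0 <= p <= 1 -> 0 <= s ->
  1 + p * (expR s - 1) <= expR (s * p + s ^+ 2 / 8).
Proof.
move=> /andP[p0 p1] s0.
pose D (x : R) := 1 + p * (expR x - 1).
have D0 x : 0 < D x by rewrite /D; have := expR_gt0 x; nra.
have dD (y : R) : is_derive y 1 D (p * expR y).
  have -> : D = cst (1 - p) + p \*: expR :> (R -> R).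
    by apply/funext => x; rewrite /D !fctE /= /GRing.scale/=; ring.
  have dE := is_deriveZ p (is_derive_expR y).
  by apply: (is_derive_eq (is_deriveD (is_derive_cst _ _ _) dE)); rewrite add0r.
pose k (x : R) := p + x / 4 - p * expR x / D x.
have dk (y : R) :
    is_derive y 1 k (1 / 4 - p * (1 - p) * expR y / (D y) ^+ 2).
  have Dn0 : D y != 0 by rewrite gt_eqF.
  have -> : k = cst p + 4^-1 \*: id - (p \*: expR) * (fun x => (D x)^-1)
      :> (R -> R).
    by apply/funext => z; rewrite /k !fctE /= /GRing.scale/= (mulrC z).
  have dlin := is_deriveD (is_derive_cst p y 1)
    (is_deriveZ 4^-1 (is_derive_id y 1)).
  have dquo := is_deriveM (is_deriveZ p (is_derive_expR y))
    (is_deriveV Dn0 (dD y)).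
  apply: (is_derive_eq (is_deriveB dlin dquo)).
  by rewrite /= /GRing.scale /= /D; rewrite /D in Dn0; field.
have dk0 (y : R) : 0 <= y -> 0 <= 1 / 4 - p * (1 - p) * expR y / (D y) ^+ 2.
  move=> _; rewrite subr_ge0 ler_pdivrMr ?exprn_gt0// /D.
  have := expR_gt0 y; have := sqr_ge0 (1 - p - p * expR y); nra.
have k0 x : 0 <= x -> 0 <= k x.
  move=> x0; have := is_derive_ge0_le dk dk0 x0.
  by rewrite {1}/k /D expR0 subrr mulr0 addr0 mul0r addr0 mulr1 divr1 subrr.
pose h x := D x * expR (- (x * p + x ^+ 2 / 8)).
have dh (y : R) : is_derive y 1 (- h : R -> R) (k y * h y).
  have -> : h = D * (expR \o (- (p \*: id + 8^-1 \*: (id ^+ 2)))).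
    apply/funext => z.
    by rewrite /h !fctE /= /GRing.scale/= (mulrC z) (mulrC 8^-1).
  have dexp := is_deriveN (is_deriveD (is_deriveZ p (is_derive_id y 1))
    (is_deriveZ 8^-1 (is_deriveX 2 (is_derive_id y 1)))).
  have dcomp := is_derive1_comp (is_derive_expR _) dexp.
  apply: (is_derive_eq (is_deriveN (is_deriveM (dD y) dcomp))).
  rewrite /k !fctE /= /GRing.scale/=.
  have Dn0 : D y != 0 by rewrite gt_eqF.
  by field.
have h0 y : 0 <= h y by rewrite mulr_ge0 ?ltW ?D0 ?expR_gt0.
have := is_derive_ge0_le dh (fun y y0 => mulr_ge0 (k0 y y0) (h0 y)) s0.
have -> : (- h) 0 = - 1.
  rewrite !fctE /h /D mul0r expr0n/= mul0r addr0 oppr0 expR0 subrr.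
  by rewrite mulr0 addr0 mulr1.
by rewrite !fctE lerN2 /h expRN ler_pdivrMr ?expR_gt0// mul1r.
Qed.

(** An indicator is 0 or 1, so each factor of the exponential is 1 + (e^s - 1) 1_A, and the product
    distributes over the subsets J. Only intersections remain, the events about which independence
    speaks. *)
Lemma expR_sum_indic (T : Type) (R : realType) (I : finType) (A : I -> set T)
    (s : R) (w : T) :
  expR (s * \sum_i \1_(A i) w) =
  \sum_(J : {set I})
     (expR s - 1) ^+ #|J| * \1_(\bigcap_(i in [set` J]) A i) w.
Proof.
rewrite mulr_sumr expR_sum.
transitivity (\prod_i ((expR s - 1) * \1_(A i) w + 1) : R).
  apply: eq_bigr => i _; rewrite indicE; case: (w \in A i).
    by rewrite !mulr1 subrK.
  by rewrite !mulr0 expR0 add0r.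
rewrite bigA_distr; apply: eq_bigr => J _.
rewrite -big_mkcond/= big_split/= prodr_const; congr (_ * _).
have [wA|/existsNP[i /not_implyP[Ji wAi]]] :=
    pselect (forall i, i \in J -> A i w).
  by rewrite indicE mem_set// big1// => i Ji; rewrite indicE mem_set//; exact: wA.
rewrite (bigD1 i)//= !indicE !memNset ?mul0r//.
by move=> /(_ i Ji).
Qed.

(** * Moments and tails of a sum of indicators of independent events *)

Section sum_indic.
Context (d : measure_display) (T : measurableType d) (R : realType)
  (P : probability T R) (I : finType) (A : I -> set T).
Hypothesis mA : forall i, measurable (A i).

Let X w := \sum_i \1_(A i) w : R.
Let EX := \sum_i fine (P (A i)).
Let n := #|[set i | (0 < P (A i) < 1)%E]%SET|.

Let mX : measurable_fun setT X.
Proof. by apply: measurable_sum => i; exact: measurable_indic. Qed.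

Lemma expectation_sum_indic : fine 'E_P[X] = EX.
Proof.
rewrite unlock; under eq_integral do rewrite -sumEFin.
rewrite ge0_integral_sum//=; last first.
  by move=> i; exact/measurable_EFinP/measurable_indic.
under eq_bigr => i _ do rewrite integral_indic// setIT.
by rewrite /EX sum_fine// => i _; exact: fin_num_measure.
Qed.

(** The sum lies between 0 and [#|I|], so its squared deviation from a constant c is at most (#|I| +
    |c|)^2, and bounded measurable functions are integrable under a probability. *)
Lemma variance_sum_indic_fin_num : 'V_P[X] \is a fin_num.
Proof.
rewrite /variance unlock; apply: expectation_fin_num; apply/Lfun1_integrable.
apply: measurable_bounded_integrable => //.
- by rewrite -ge0_fin_numE// fin_num_measure.
- by apply: measurable_funM; apply: measurable_funB.
set c := fine _.
exists ((#|I|%:R + `|c|) ^+ 2); split; first exact: num_real.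
move=> M /ltW cM w _; apply: le_trans cM.
rewrite -[X in `|X|]/((X w - c) ^+ 2) normrX ler_sqr ?nnegrE ?addr_ge0//.
rewrite (le_trans (ler_normB _ _))// lerD2r ger0_norm ?sumr_ge0//.
rewrite -sum1_card natr_sum ler_sum// => i _.
by rewrite indicE lern1 leq_b1.
Qed.

Hypothesis indep : forall J : {set I},
  P (\bigcap_(i in [set` J]) A i) = (\prod_(i in J) P (A i))%E.

(** The subset expansion is integrated term by term, independence splits the probability of each
    intersection, and the same distributive law folds the sum back into a product. Since s >= 0, the
    coefficients (e^s - 1)^#|J| are nonnegative, so sum and integral commute. *)
Lemma mmt_gen_fun_sum_indic (s : R) : 0 <= s ->
  'M_P X s = (\prod_i (1 + fine (P (A i)) * (expR s - 1)))%:E.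
Proof.
move=> s0.
have es0 : 0 <= expR s - 1 by rewrite subr_ge0 -expR0 ler_expR.
have mJ (J : {set I}) : measurable (\bigcap_(i in [set` J]) A i).
  by apply: fin_bigcap_measurable => //; exact: finite_finset.
rewrite /mmt_gen_fun unlock.
under eq_integral => w _.
  rewrite /= mulrC expR_sum_indic -sumEFin.
  under eq_bigr => J _ do rewrite EFinM.
  over.
rewrite ge0_integral_sum//=; last 2 first.
- move=> J; apply: emeasurable_funM => //.
  exact/measurable_EFinP.
- by move=> J w _; rewrite -EFinM lee_fin mulr_ge0// exprn_ge0.
transitivity (\sum_(J : {set I})
    (\prod_(i in J) (fine (P (A i)) * (expR s - 1)))%:E)%E.
  apply: eq_bigr => J _.
  rewrite ge0_integralZl_EFin ?exprn_ge0//; last exact/measurable_EFinP.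
  rewrite integral_indic// setIT.
  rewrite [X in (_ * X)%E](indep J) big_split/= prodr_const EFinM muleC.
  congr (_ * _)%E.
  rewrite -prodEFin; apply: eq_bigr => i _.
  by rewrite fineK// fin_num_measure.
rewrite sumEFin; congr EFin.
under [RHS]eq_bigr do rewrite addrC.
rewrite bigA_distr; apply: eq_bigr => J _.
by rewrite -big_mkcond.
Qed.

Lemma chernoff_sum_indic (a s : R) : 0 < s ->
  (P [set w | (a <= X w)%R] <=
   (expR (- (s * (a - EX)) + n%:R * (s ^+ 2 / 8)))%:E)%E.
Proof.
move=> s0.
pose X' : {RV P >-> R} := HB.pack X (isMeasurableFun.Build _ _ _ _ X mX).
apply: (le_trans (chernoff X' a s0)).
rewrite (mmt_gen_fun_sum_indic (ltW s0)) -EFinM lee_fin.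
rewrite mulrBr opprB addrAC expRD ler_pM2r ?expR_gt0//.
have -> (c : R) : n%:R * c = \sum_i (if (0 < P (A i) < 1)%E then c else 0).
  (* The total n * c is spread over all indices, with c at the random events and 0 elsewhere, so
     that the two sides can be compared factor by factor. *)
  by rewrite -big_mkcond sumr_const /n cardsE mulr_natl.
rewrite mulr_sumr -big_split/= expR_sum.
apply: ler_prod => i _.
have p0 : 0 <= fine (P (A i)) by rewrite fine_ge0.
have p1 : fine (P (A i)) <= 1.
  by rewrite -lee_fin fineK ?fin_num_measure// probability_le1.
rewrite addr_ge0 ?mulr_ge0// ?subr_ge0 -?expR0 ?ler_expR ?(ltW s0)//= expR0.
case: ifPn => [_|].
  by apply: bernoulli_hoeffding; rewrite ?p0 ?p1 ?(ltW s0).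
(* For a probability p equal to 0 or 1 the factor is exactly e^(s p), without the quadratic term. *)
rewrite -[P _]fineK ?fin_num_measure// !lte_fin.
rewrite negb_and -!leNgt => /orP[p_le0|p_ge1].
  have -> : fine (P (A i)) = 0 by lra.
  by rewrite mul0r mulr0 !addr0 expR0.
have -> : fine (P (A i)) = 1 by lra.
by rewrite mul1r mulr1 addr0 addrC subrK.
Qed.

Lemma hoeffding_sum_indic (a : R) : EX < a -> (0 < n)%N ->
  (P [set w | (a <= X w)%R] <= (expR (- (2 * (a - EX) ^+ 2 / n%:R)))%:E)%E.
Proof.
move=> EXa n0.
have nR0 : 0 < n%:R :> R by rewrite ltr0n.
(* This s minimizes the Chernoff exponent - s (a - EX) + n s^2 / 8; the minimum is - 2 (a - EX)^2 /
   n. *)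
have s0 : 0 < 4 * (a - EX) / n%:R by rewrite divr_gt0// mulr_gt0// subr_gt0.
apply: (le_trans (chernoff_sum_indic a s0)).
rewrite lee_fin ler_expR le_eqVlt; apply/orP; left; apply/eqP.
by field; rewrite gt_eqF.
Qed.

Lemma sum_indic_tail_eq0 (a : R) : EX < a -> n = 0%N ->
  P [set w | (a <= X w)%R] = 0%E.
Proof.
move=> EXa n0.
have mXa : measurable [set w | a <= X w].
  by rewrite -[X in measurable X]setTI; apply: measurable_fun_le.
have Pfin := fin_num_measure P _ mXa.
rewrite -[LHS]fineK//; congr EFin.
apply/eqP; rewrite eq_le fine_ge0// andbT leNgt.
apply/negP; set x := fine _ => x0.
(* s (a - EX) = 1 / x, and exp (- 1 / x) < x *)
have s0 : 0 < (x * (a - EX))^-1 by rewrite invr_gt0 mulr_gt0// subr_gt0.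
have := chernoff_sum_indic a s0.
rewrite -[X in (X <= _)%E]fineK// lee_fin n0 mul0r addr0 -/x leNgt.
move=> /negP; apply.
rewrite invfM -mulrA mulVf ?mulr1 ?gt_eqF ?subr_gt0//.
rewrite expRN invf_plt ?posrE ?expR_gt0//.
by rewrite (lt_le_trans _ (expR_ge1Dx _))// ltrDr ltr01.
Qed.

End sum_indic.

(** The upper tail lies inside the two-sided deviation event at distance a - E X > 0. Finiteness of
    the variance makes the square of [Std], defined through [fine], the variance itself. *)
Lemma chebyshev_upper_tail (d : measure_display) (T : measurableType d)
    (R : realType) (P : probability T R) (X : {RV P >-> R}) (a : R) :
  'V_P[X] \is a fin_num -> fine 'E_P[X] < a ->
  (P [set w | (a <= X w)%R] <= ((Std P X / (a - fine 'E_P[X])) ^+ 2)%:E)%E.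
Proof.
move=> Vfin EXa; have aE0 : 0 < a - fine 'E_P[X] by rewrite subr_gt0.
have sub : [set w | a <= X w] `<=`
    [set w | a - fine 'E_P[X] <= `|X w - fine 'E_P[X]|].
  by move=> w /= aX; rewrite (le_trans _ (ler_norm _))// lerD2r.
have mX : measurable_fun setT (X : T -> R) by exact: measurable_funP.
apply: (@le_trans _ _ (P [set w | a - fine 'E_P[X] <= `|X w - fine 'E_P[X]|])).
  apply: le_measure; rewrite ?inE//; rewrite -[X in measurable X]setTI;
    apply: measurable_fun_le => //.
  by apply: measurableT_comp => //; exact: measurable_funB.
apply: (le_trans (chebyshev X aE0)).
rewrite expr_div_n sqr_sqrtr; last by rewrite fine_ge0// variance_ge0.
by rewrite mulrC EFinM fineK.
Qed.

(** * Perishing counts and the offset event *)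

Section perishing.
Context (d : measure_display) (T : measurableType d) (R : realType)
  (P : probability T R) (I : finType) (perish : I -> {RV P >-> nat}).

Lemma perished_beforeE (t : nat) (w : T) :
  perished_before perish t w = #|[set b | (perish b w < t)%N]%SET|%:R.
Proof.
rewrite /perished_before cardsE -sum1_card natr_sum [RHS]big_mkcond.
apply: eq_bigr => b _; rewrite indicE unfold_in /=.
by case: ifPn => h; [rewrite mem_set|rewrite memNset//; exact/negP].
Qed.

Lemma measurable_perish_lt (b : I) (t : nat) :
  measurable [set w | (perish b w < t)%N].
Proof.
rewrite -[X in measurable X]setTI.
exact: (measurable_funP (perish b) _ [set k | (k < t)%N]).
Qed.

Lemma measurable_perished_before (t : nat) :
  measurable_fun setT (perished_before perish t).
Proof.
apply: measurable_sum => b; apply: measurable_indic.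
exact: measurable_perish_lt.
Qed.

Lemma perished_before_tail (t : nat) :
  mutually_independent perish -> mean_perished_before perish t < t%:R ->
  (P [set w | (t%:R <= perished_before perish t w)%R] <=
   (Num.min (chebyshev_term perish t) (hoeffding_term perish t)
    * (0 < #|random_units_before perish t|)%N%:R)%:E)%E.
Proof.
move=> indep EXt.
pose A b := [set w | (perish b w < t)%N].
have mA b : measurable (A b) by exact: measurable_perish_lt.
have indepA (J : {set I}) :
    P (\bigcap_(b in [set` J]) A b) = (\prod_(b in J) P (A b))%E.
  exact: (indep J (fun=> [set k | (k < t)%N])).
have EXE : mean_perished_before perish t = \sum_b fine (P (A b)).
  exact: expectation_sum_indic.
have EXt' : \sum_b fine (P (A b)) < t%:R by rewrite -EXE.
(* Without random units the indicator factor makes the bound 0, so the tail itself has to be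
   null. *)
have [n0|n0] := posnP #|random_units_before perish t|.
  by rewrite mulr0 (sum_indic_tail_eq0 mA indepA EXt' n0).
rewrite mulr1 EFin_min le_min; apply/andP; split.
  pose X : {RV P >-> R} := HB.pack (perished_before perish t : T -> R)
    (isMeasurableFun.Build _ _ _ _ _ (measurable_perished_before t)).
  apply: (@chebyshev_upper_tail _ _ _ _ X) => //.
  exact: variance_sum_indic_fin_num.
rewrite /hoeffding_term EXE.
exact: (hoeffding_sum_indic mA indepA EXt' n0).
Qed.

Variable N : nat -> {RV P >-> nat}.

(** The count is a natural number, so being below t means being at most t - 1, the number of
    arrivals before t. Both fractions have denominator h, which cancels. *)
Lemma sub_offset_event (h : nat) : #|I| = h ->
  [set w | forall t, (1 <= t <= h)%N -> N t w = 1%N] `&`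
    [set w | forall t, (2 <= t <= h)%N -> perished_before perish t w < t%:R]
  `<=` offset_event perish h N.
Proof.
move=> cardI w [/= N1 Xlt] t /andP[t2 th].
(* The range includes u = h + 1 because the total number of arrivals is the count before round h +
   1. *)
have arrivalsE u : (u <= h.+1)%N -> arrivals_before N u w = u.-1.
  move=> uh; rewrite /arrivals_before.
  rewrite (eq_big_nat _ _ (F2 := fun=> 1%N)).
    by rewrite sum_nat_const_nat muln1 subn1.
  move=> s /andP[s1 su]; apply: N1; rewrite s1/=.
  by rewrite -ltnS (leq_trans su).
rewrite /total_arrivals (arrivalsE t (leqW th)) (arrivalsE h.+1 (leqnn _)).
rewrite cardI ler_pM2r; last first.
  by rewrite invr_gt0 ltr0n (leq_trans _ th)// (leq_trans _ t2).
have := Xlt t; rewrite t2 th => /(_ isT).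
by rewrite perished_beforeE ltr_nat ler_nat; case: t t2 {th}.
Qed.

Lemma measurable_offset_event (h : nat) : measurable (offset_event perish h N).
Proof.
have mN t : measurable_fun setT (arrivals_before N t).
  rewrite /arrivals_before /index_iota.
  elim: (iota _ _) => [|k s IHs].
    under eq_fun do rewrite big_nil.
    exact: measurable_cst.
  under eq_fun do rewrite big_cons.
  by apply: measurable_fun_addn.
(* Every function on [nat] is measurable; this covers both the cast of the arrivals and the inverse
   of their total. *)
have mnat (f : nat -> R) t :
    measurable_fun setT (fun w => f (arrivals_before N t w)).
  exact: measurableT_comp.
have -> : offset_event perish h N =
  \bigcap_(t in [set t | (2 <= t <= h)%N]) ([set: T] `&` [set w |
     perished_before perish t w / #|I|%:R <=
     (arrivals_before N t w)%:R / (total_arrivals N h w)%:R]).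
  apply/seteqP; split=> w.
    by move=> oe t th; split=> //; exact: oe.
  by move=> oe t th; have [] := oe t th.
apply: bigcap_measurableType => // t _; apply: measurable_fun_le => //.
  by apply: measurable_funM => //; exact: measurable_perished_before.
apply: measurable_funM; first exact: mnat.
exact: (mnat (fun k => k%:R^-1)).
Qed.

End perishing.

Theorem proposition2 (d : measure_display) (Omega : measurableType d)
    (R : realType) (P : probability Omega R)
    (T : nat) (Unit : finType) (card_Unit : #|Unit| = T)
    (N : nat -> {RV P >-> nat})
    (one_arrival : {ae P, forall w, forall t : nat,
                      (1 <= t <= T)%N -> N t w = 1%N})
    (perish : Unit -> {RV P >-> nat})
    (perish_ge1 : forall b w, (1 <= perish b w)%N)
    (perish_iid : iid perish)
    (mean_le : forall t : nat, (2 <= t <= T)%N ->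
                 ('E_P[perished_before perish t] <= (t%:R - 1)%:E)%E)
    (delta : R) (delta_gt0 : 0 < delta) (delta_lt1 : delta < 1)
    (delta_ge :
       \sum_(2 <= t < T.+1)
          Num.min (chebyshev_term perish t) (hoeffding_term perish t)
          * (0 < #|random_units_before perish t|)%N%:R
       <= delta) :
  offset_expiring perish T N delta.
Proof.
have [Z [mZ PZ0 subZ]] := one_arrival.
have moff := measurable_offset_event perish N T.
pose E t : set Omega := [set w | t%:R <= perished_before perish t w].
have mE t : measurable (E t).
  rewrite -[X in measurable X]setTI; apply: measurable_fun_le => //.
  exact: measurable_perished_before.
(* The indices 0 and 1 carry no deadline event, so they hold the null set [Z] of bad arrivals; a
   single union over t <= T then covers all failures, and these two indices add nothing to the
   sum. *)
pose F t := if (2 <= t)%N then E t else Z.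
have mF t : measurable (F t) by rewrite /F; case: ifP.
suff PC : (P (~` offset_event perish T N) <= delta%:E)%E.
  have moffC := measurableC moff.
  have Pfin := fin_num_measure P _ moff.
  move: PC; rewrite /offset_expiring probability_setC// -[P _]fineK//.
  by rewrite -EFinB !lee_fin; lra.
have sub : ~` offset_event perish T N `<=` \big[setU/set0]_(t < T.+1) F t.
  rewrite -bigcup_mkord => w woff; apply: contrapT => wF.
  apply: woff; apply: sub_offset_event => //; split=> /=.
    apply: contrapT => /subZ Zw; apply: wF; exists 0%N => //.
  move=> t /andP[t2 tT]; rewrite ltNge; apply/negP => Et.
  by apply: wF; exists t => //; rewrite /F t2.
apply: le_trans.
  by apply: (content_subadditive _ _ _ sub) => //; exact: measurableC.
apply: (@le_trans _ _ (\sum_(2 <= t < T.+1) P (E t))%E).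
  rewrite (big_nat_widenl 2 0)// big_mkord [leRHS]big_mkcond.
  apply: lee_sum => t _; rewrite /F; case: ifP => //.
  by rewrite [X in (X <= _)%E]PZ0.
move: delta_ge; rewrite -lee_fin; apply: le_trans.
rewrite -sumEFin big_nat [leRHS]big_nat; apply: lee_sum => t /andP[t2 tT].
apply: perished_before_tail; first by case: perish_iid.
have := mean_le t; rewrite t2 -ltnS tT => /(_ isT) mt.
(* Nonnegativity and the upper bound t - 1 make the mean finite, so the bound passes to its real
   value [fine] and leaves the strict gap below t that the tail bounds require. *)
have Eint : (0 <= 'E_P[perished_before perish t])%E.
  by apply: expectation_ge0 => w; exact: sumr_ge0.
rewrite /mean_perished_before (@le_lt_trans _ _ (t%:R - 1))//; last first.
  by rewrite ltrBlDr ltrDl.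
by rewrite -lee_fin fineK// ge0_fin_numE// (le_lt_trans mt)// ltry.
Qed.
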